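(* Let $n$ be an arbitrary positive integer. If a Hausdorff topological semigroup $S$ contains $\mathscr{IPF}(\mathbb{N}^n)$ as a dense subsemigroup, then the square $S\times S$ is not feebly compact.
   Context: $\mathbb{N}$ is the set of positive integers; $(\mathbb{N}^n,\leqslant)$ carries the product (coordinatewise) order; ${\uparrow}\mathbf{x}=\{\mathbf{y}\in\mathbb{N}^n:\mathbf{x}\leqslant\mathbf{y}\}$ is the principal filter generated by $\mathbf{x}$. $\mathscr{IPF}(\mathbb{N}^n)$ is the semigroup of all order isomorphisms between principal filters of $(\mathbb{N}^n,\leqslant)$, with composition of partial maps (maps written on the right, composed left to right, $z(\alpha\beta)=(z\alpha)\beta$ wherever defined). A topological semigroup is a topological space with a (jointly) continuous semigroup operation. A topological space $X$ is feebly compact if each locally finite open cover of $X$ is finite (for Hausdorff $X$ this is equivalent to: every locally finite family of non-empty open subsets of $X$ is finite). *)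

(* Defs.v *)
From HB Require Import structures.
From mathcomp Require Import all_boot all_order.
From mathcomp Require Import all_classical all_analysis.

Set Implicit Arguments.
Unset Strict Implicit.
Unset Printing Implicit Defensive.

Import Order.TTheory.
Local Open Scope classical_set_scope.

Record posnat := PosNat { posnat_val :> nat; _ : (0 < posnat_val)%N }.

HB.instance Definition _ := [isSub for posnat_val].
HB.instance Definition _ := [Choice of posnat by <:].
HB.instance Definition _ :=
  [SubChoice_isSubOrder of posnat by <: with Order.default_display].

Section PrincipalFilterIsomorphisms.
Local Open Scope order_scope.
Context {d : Order.disp_t}.

Definition principal_filter {P : porderType d} (x : P) : set P :=
  [set y | x <= y].

(* A partial self-map of P is encoded as a function P -> option P. *)
Definition pmap_dom {P : Type} (f : P -> option P) : set P :=
  [set z | exists w, f z = Some w].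

Definition pmap_codom {P : Type} (f : P -> option P) : set P :=
  [set w | exists z, f z = Some w].

(* Injectivity of f on its domain follows from the last clause by
   antisymmetry, so f is an order isomorphism from its domain to its range. *)
Definition principal_filter_iso {P : porderType d} (f : P -> option P) : Prop :=
  exists x y : P,
    [/\ pmap_dom f = principal_filter x,
        pmap_codom f = principal_filter y &
        forall z1 z2 w1 w2, f z1 = Some w1 -> f z2 = Some w2 ->
          (w1 <= w2) = (z1 <= z2)].

Record ipf (P : porderType d) := Ipf {
  ipf_fun :> P -> option P;
  _ : `[< principal_filter_iso ipf_fun >]
}.

HB.instance Definition _ (P : porderType d) := [isSub for @ipf_fun P].
HB.instance Definition _ (P : porderType d) := [Choice of ipf P by <:].

End PrincipalFilterIsomorphisms.

Section PrincipalFilterIsomorphismSemigroup.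
Local Open Scope order_scope.
Context {d : Order.disp_t} {L : latticeType d}.
Implicit Types f g h : ipf L.

(* pcomp g f is "f, then g" *)
Lemma ipf_mul_subproof f g : `[< principal_filter_iso (pcomp g f) >].
Proof.
case: f g => f /= /asboolP[x [y [fdom fcod fle]]] [g /= /asboolP[u [v]]].
case=> gdom gcod gle; apply/asboolP.
have fD z w : f z = Some w -> x <= z.
  by move=> fz; have : pmap_dom f z by [exists w]; rewrite fdom.
have fC w : y <= w -> exists z, f z = Some w.
  by move=> yw; have : principal_filter y w by []; rewrite -fcod.
have fC' z w : f z = Some w -> y <= w.
  by move=> fz; have : pmap_codom f w by [exists z]; rewrite fcod.
have fT z : x <= z -> exists w, f z = Some w.
  by move=> xz; have : principal_filter x z by []; rewrite -fdom.
have gT z : u <= z -> exists w, g z = Some w.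
  by move=> xz; have : principal_filter u z by []; rewrite -gdom.
have gD z w : g z = Some w -> u <= z.
  by move=> gz; have : pmap_dom g z by [exists w]; rewrite gdom.
have gC w : v <= w -> exists z, g z = Some w.
  by move=> vw; have : principal_filter v w by []; rewrite -gcod.
have gC' z w : g z = Some w -> v <= w.
  by move=> gz; have : pmap_codom g w by [exists z]; rewrite gcod.
have [x' fx'] := fC _ (leUl y u).
have [v' gv'] := gT _ (leUr u y).
exists x', v'; split.
- apply/seteqP; split=> z /=.
    rewrite /pmap_dom /principal_filter /= /pcomp => -[w].
    case fz: (f z) => [t|] //= gt.
    by rewrite -(fle _ _ _ _ fx' fz) leUx (fC' _ _ fz) (gD _ _ gt).
  rewrite /pmap_dom /principal_filter /= /pcomp => x'z.
  have [t ft] := fT _ (le_trans (fD _ _ fx') x'z).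
  have : y `|` u <= t by rewrite (fle _ _ _ _ fx' ft).
  by rewrite leUx ft /= => /andP[_ /gT].
- apply/seteqP; split=> w /=.
    rewrite /pmap_codom /principal_filter /= /pcomp => -[z].
    case fz: (f z) => [t|] //= gt.
    by rewrite (gle _ _ _ _ gv' gt) leUx (fC' _ _ fz) (gD _ _ gt).
  rewrite /pmap_codom /principal_filter /= /pcomp => v'w.
  have [t gt] := gC _ (le_trans (gC' _ _ gv') v'w).
  have : y `|` u <= t by rewrite -(gle _ _ _ _ gv' gt).
  by rewrite leUx => /andP[/fC[z fz] _]; exists z; rewrite fz.
- move=> z1 z2 w1 w2; rewrite /pcomp.
  case fz1: (f z1) => [t1|] //= gt1; case fz2: (f z2) => [t2|] //= gt2.
  by rewrite (gle _ _ _ _ gt1 gt2) (fle _ _ _ _ fz1 fz2).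
Qed.

Definition ipf_mul f g : ipf L := Ipf (ipf_mul_subproof f g).

Lemma ipf_mulA : associative ipf_mul.
Proof.
by move=> f g h; apply/val_inj/funext => z /=; rewrite /pcomp; case: (f z).
Qed.

HB.instance Definition _ := isSemigroup.Build (ipf L) ipf_mulA.

End PrincipalFilterIsomorphismSemigroup.

Notation IPF_N n := (ipf (n.-tupleprod posnat)).

HB.mixin Record isTopologicalSemigroup S of Topological S & Semigroup S := {
  mulg_continuous : continuous (fun p : S * S => (p.1 * p.2)%g)
}.

#[short(type="topologicalSemigroupType")]
HB.structure Definition TopologicalSemigroup :=
  {S of isTopologicalSemigroup S & Topological S & Semigroup S}.

Definition locally_finite {T : topologicalType} (F : set (set T)) : Prop :=
  forall x : T, exists2 U, nbhs x U & finite_set [set A | F A /\ A `&` U !=set0].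

Definition feebly_compact (T : topologicalType) : Prop :=
  forall F : set (set T),
    F `<=` open -> cover F id = setT -> locally_finite F -> finite_set F.

(* Main.v *)
Require Import Defs.
From mathcomp Require Import all_boot all_order.
From mathcomp Require Import all_classical all_analysis.
From mathcomp Require Import zify.

Set Implicit Arguments.
Unset Strict Implicit.
Unset Printing Implicit Defensive.

Import Order.TTheory.
Local Open Scope classical_set_scope.

(* Let I denote the semigroup and 1 its identity. Two points x, y of N^n being
   fixed, only finitely many elements of I map x to y: such an element is
   determined by its base point and by the images of that point and of the atoms
   above it. Hence I has a finite group of units, and for a in I the equations
   a b = 1 and b a = 1 have finitely many solutions b in I.
   Write e_k for the identity of the filter of the points with k-th coordinate
   at least 2. An element u of I is a unit iff e_k u <> u and u e_k <> u for all
   k; these inequations define an open set of S, whose trace on the dense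
   subset I is finite, so it is itself finite and 1 is isolated in S. Therefore
   D = {(x, y) | x y = 1} is clopen in S x S. If x y = 1, then x and y have open
   neighbourhoods whose product is {1}; by finiteness of the solution sets
   they have finite traces on I, so x and y are isolated. Thus D is a clopen set
   of isolated points. It is infinite, since it contains the pairs of mutually
   inverse translations, whereas in a feebly compact space such a set is
   finite. *)

(** * Order isomorphisms between principal filters, evaluated pointwise *)

Section PrincipalFilterIso.
Local Open Scope order_scope.
Context {d : Order.disp_t} {P : porderType d}.
Implicit Types (f g : ipf P) (x y z w : P).

Lemma ipf_le f z1 z2 w1 w2 :
  f z1 = Some w1 -> f z2 = Some w2 -> (w1 <= w2) = (z1 <= z2).
Proof. by case: f => f /= /asboolP[x [y [_ _]]]; apply. Qed.

Lemma ipf_base f : exists x y,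
  [/\ f x = Some y, forall z w, f z = Some w -> x <= z
    & forall z w, f z = Some w -> y <= w].
Proof.
case: f => f /= /asboolP[x [y [fdom fcod fle]]].
have xP z w : f z = Some w -> x <= z.
  by move=> fz; have : pmap_dom f z by [exists w]; rewrite fdom.
have yP z w : f z = Some w -> y <= w.
  by move=> fz; have : pmap_codom f w by [exists z]; rewrite fcod.
exists x, y; split=> //.
have [w fx] : pmap_dom f x by rewrite fdom; exact: lexx.
have [z fz] : pmap_codom f y by rewrite fcod; exact: lexx.
rewrite fx; congr Some; apply/le_anti.
by rewrite (fle _ _ _ _ fx fz) (xP _ _ fz) (yP _ _ fx).
Qed.

Lemma ipf_dom_up f z z' w :
  f z = Some w -> z <= z' -> exists w', f z' = Some w'.
Proof.
case: f => f /= /asboolP[x [y [fdom _ _]]] fz zz'.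
have : pmap_dom f z by exists w.
by rewrite fdom => /le_trans/(_ zz') xz'; have : pmap_dom f z' by rewrite fdom.
Qed.

Lemma ipf_codom_up f z w w' :
  f z = Some w -> w <= w' -> exists z', f z' = Some w'.
Proof.
case: f => f /= /asboolP[x [y [_ fcod _]]] fz ww'.
have : pmap_codom f w by exists z.
by rewrite fcod => /le_trans/(_ ww') yw'; have : pmap_codom f w' by rewrite fcod.
Qed.

Lemma ipf_inj f z1 z2 w : f z1 = Some w -> f z2 = Some w -> z1 = z2.
Proof.
move=> f1 f2; apply/le_anti.
by rewrite -(ipf_le f1 f2) -(ipf_le f2 f1) lexx.
Qed.

Lemma ipf_lt f z1 z2 w1 w2 :
  f z1 = Some w1 -> f z2 = Some w2 -> (w1 < w2) = (z1 < z2).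
Proof. by move=> f1 f2; rewrite !lt_leAnge (ipf_le f1 f2) (ipf_le f2 f1). Qed.

End PrincipalFilterIso.

(** The domain and the range are up-closed, so the join of the arguments has an image and the join
    of the values has a preimage; comparing the two through [ipf_le] gives equality. *)
Lemma ipf_join {d : Order.disp_t} {L : latticeType d} (f : ipf L)
    (z1 z2 w1 w2 : L) :
  f z1 = Some w1 -> f z2 = Some w2 -> f (z1 `|` z2)%O = Some (w1 `|` w2)%O.
Proof.
move=> f1 f2; have [c fc] := ipf_dom_up f1 (leUl z1 z2).
have [t ft] := ipf_codom_up f1 (leUl w1 w2).
rewrite fc; congr Some; apply/le_anti/andP; split.
  by rewrite (ipf_le fc ft) leUx -(ipf_le f1 ft) -(ipf_le f2 ft) leUl leUr.
by rewrite leUx (ipf_le f1 fc) (ipf_le f2 fc) leUl leUr.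
Qed.

(** * Coordinates and covers in the product order; finiteness of the maps through a given pair *)

Section PosTuple.
Local Open Scope order_scope.
Context {n : nat}.
Notation P := (n.-tupleprod posnat).
Implicit Types (x y z w : P) (h : 'I_n -> nat) (i j : 'I_n).

(* Coordinates are shifted by one, so that they range over all of [nat]. *)
Definition coord z i : nat := (posnat_val (tnth z i)).-1.

Definition of_coord h : P := [tuple PosNat (ltn0Sn (h i)) | i < n].

Lemma of_coordK h : coord (of_coord h) =1 h.
Proof. by move=> i; rewrite /coord tnth_mktuple. Qed.

Lemma posnat_le (a b : posnat) : (a <= b) = (a.-1 <= b.-1)%N.
Proof.
have -> : (a <= b) = (posnat_val a <= posnat_val b)%N by [].
by case: a b => [a ha] [b hb] /=; lia.
Qed.

Lemma le_coordP z w : reflect (forall i, (coord z i <= coord w i)%N) (z <= w).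
Proof.
rewrite leEtprod; apply: (iffP forallP) => zw i; have := zw i;
  by rewrite posnat_le.
Qed.

Lemma coord_inj z w : coord z =1 coord w -> z = w.
Proof.
move=> zw; apply/le_anti/andP; split; apply/le_coordP => i;
  by rewrite zw.
Qed.

Definition pbot : P := of_coord (fun=> 0%N).

Lemma le_pbot z : pbot <= z.
Proof. by apply/le_coordP => i; rewrite of_coordK. Qed.

Definition incr i z : P := of_coord (fun j => (j == i) + coord z j)%N.

Lemma coord_incr i z j : coord (incr i z) j = ((j == i) + coord z j)%N.
Proof. exact: of_coordK. Qed.

Lemma le_incr i z : z <= incr i z.
Proof. by apply/le_coordP => j; rewrite coord_incr leq_addl. Qed.

Lemma lt_incr i z : z < incr i z.
Proof.
rewrite lt_leAnge le_incr; apply/negP => /le_coordP/(_ i).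
by rewrite coord_incr eqxx add1n ltnn.
Qed.

Lemma incr_injl z i j : incr i z = incr j z -> i = j.
Proof.
move=> /(congr1 (coord ^~ i)); rewrite !coord_incr eqxx.
by case: eqP => // _; lia.
Qed.

(** Together with [lt_incr], this makes the points [incr i z] the covers of [z], a notion that order
    isomorphisms respect. *)
Lemma lt_incr_le z w : z < w -> exists i, incr i z <= w.
Proof.
rewrite lt_leAnge => /andP[/le_coordP zw /le_coordP wz].
have [i zwi] : exists i, (coord z i < coord w i)%N.
  apply: contrapT => ne; apply: wz => i; rewrite leqNgt; apply/negP => lti.
  by apply: ne; exists i.
exists i; apply/le_coordP => j; rewrite coord_incr.
by have := zw j; case: eqP => [->|] //=.
Qed.

Lemma join_incr i j z : i != j -> incr i (incr j z) = incr i z `|` incr j z.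
Proof.
move=> ij; apply/le_anti/andP; split.
  have /le_coordP := leUl (incr i z) (incr j z).
  have /le_coordP := leUr (incr j z) (incr i z).
  move=> uj ui; apply/le_coordP => k.
  move: (uj k) (ui k); rewrite !coord_incr; case: eqP => [->|_] //.
  by rewrite eq_sym (negPf ij).
rewrite leUx; apply/andP; split; apply/le_coordP => k; rewrite !coord_incr;
  lia.
Qed.

(** Induction on the sum of the coordinates: a point strictly above [x] can be lowered by one in
    some coordinate and stay above [x]. *)
Lemma incr_ind x (Q : P -> Prop) :
  Q x -> (forall z i, x <= z -> Q z -> Q (incr i z)) ->
  forall z, x <= z -> Q z.
Proof.
move=> Qx Qb z; have [m] := ubnP (\sum_i coord z i)%N.
elim: m z => // m IH z ltzm xz.
have [<-//|nxz] := eqVneq x z.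
have /lt_incr_le[i /le_coordP bz] : x < z by rewrite lt_neqAle nxz.
have zi : (0 < coord z i)%N.
  by apply: leq_trans (bz i); rewrite coord_incr eqxx.
pose z' := of_coord (fun j => coord z j - (j == i))%N.
have z'i j : coord z' j = (coord z j - (j == i))%N by exact: of_coordK.
have <- : incr i z' = z.
  apply: coord_inj => j; rewrite coord_incr z'i.
  by case: eqP => [->|_] /=; lia.
apply: Qb.
  by apply/le_coordP => j; have := bz j; rewrite coord_incr z'i; lia.
apply: IH; last first.
  by apply/le_coordP => j; have := bz j; rewrite coord_incr z'i; lia.
rewrite -ltnS; apply: leq_trans ltzm; rewrite ltnS.
rewrite [ltnRHS](bigD1 i) //= [ltnLHS](bigD1 i) //=.
rewrite -addSn leq_add //; first by rewrite z'i eqxx; lia.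
by apply: leq_sum => j _; rewrite z'i leq_subr.
Qed.

Implicit Types f g : ipf P.

(** Covers go to covers: the image of [incr i z] lies above some cover [incr j w], whose preimage is
    squeezed between [z] and [incr i z], strictly above [z]. *)
Lemma ipf_incr f z w i :
  f z = Some w -> exists j, f (incr i z) = Some (incr j w).
Proof.
move=> fz; have [w' fb] := ipf_dom_up fz (le_incr i z).
have /lt_incr_le[j wj] : w < w' by rewrite (ipf_lt fz fb) lt_incr.
exists j; have [t ft] := ipf_codom_up fz (le_incr j w).
have /lt_incr_le[k kt] : z < t by rewrite -(ipf_lt fz ft) lt_incr.
have tb : t <= incr i z by rewrite -(ipf_le ft fb).
suff <- : t = incr i z by [].
apply/le_anti; rewrite tb.
suff <- : k = i by [].
have /le_coordP/(_ k) := le_trans kt tb.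
by rewrite !coord_incr eqxx; case: eqP => // _; lia.
Qed.

(* The only delicate values are those at [z + 2 e_i]: there an injectivity
   argument is needed, since [z + 2 e_i] is not a join of smaller elements. *)
Lemma ipf_eq_up f g x y :
  f x = Some y -> g x = Some y ->
  (forall i, f (incr i x) = g (incr i x)) ->
  forall z, x <= z -> f z = g z.
Proof.
move=> fx gx fgx.
(* The induction carries agreement at [z] and at all covers of [z]. *)
suff H z : x <= z -> f z = g z /\ forall i, f (incr i z) = g (incr i z).
  by move=> z /H[].
move: z; apply: incr_ind => [|z i xz [fgz fgb]]; first by rewrite fx gx.
split=> // j; have [w fz] := ipf_dom_up fx xz.
have gz : g z = Some w by rewrite -fgz.
have fgne k : k != i -> f (incr k (incr i z)) = g (incr k (incr i z)).
  move=> ki; rewrite join_incr //.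
  have [wk fk] := ipf_incr k fz; have [wi fi] := ipf_incr i fz.
  by rewrite (ipf_join fk fi) (@ipf_join _ _ g _ _ (incr wk w) (incr wi w)) //
    -fgb.
have [->|/fgne//] := eqVneq j i.
have [wi fi] := ipf_incr i fz; have gi := fi; rewrite fgb in gi.
have [k fk] := ipf_incr i fi; have [l gl] := ipf_incr i gi.
(* Let [t] be the [f]-preimage of the value of [g] at [incr i (incr i z)]. It is a cover of
   [incr i z]; in a direction other than [i], where [f] and [g] agree, it would break the
   injectivity of [g]. *)
have [t ft] := ipf_codom_up fi (le_incr l (incr wi w)).
have : incr i z < t by rewrite -(ipf_lt fi ft) lt_incr.
move=> /lt_incr_le[m mt].
have [mw fm] := ipf_incr m fi.
have tm : t = incr m (incr i z).
  apply/le_anti; rewrite mt andbT -(ipf_le ft fm).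
  have : incr mw (incr wi w) <= incr l (incr wi w) by rewrite (ipf_le fm ft).
  move=> /le_coordP/(_ mw); rewrite !coord_incr eqxx.
  by case: (eqVneq mw l) => [->|_] //; lia.
have [mi|mi] := eqVneq m i; first by rewrite gl -ft tm mi.
have : incr m (incr i z) = incr i (incr i z).
  by apply: (@ipf_inj _ _ g _ _ (incr l (incr wi w))) => //; rewrite -fgne // -tm.
by move=> /incr_injl e; rewrite e eqxx in mi.
Qed.

Lemma finite_ipf_through x y : finite_set [set f : ipf P | f x = Some y].
Proof.
(* The box must hold all points below [x] or [y] together with their covers: one unit for the
   covers, one for the strict bound. *)
pose N := (\max_i (maxn (coord x i) (coord y i))).+2.
pose B := {ffun 'I_n -> 'I_N}.
pose T (b : B) : P := of_coord (fun i => b i).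
have TP z : (forall i, (coord z i < N)%N) -> exists b, T b = z.
  move=> zN; exists [ffun i => Ordinal (zN i)]; apply: coord_inj => i.
  by rewrite of_coordK ffunE.
(* The code is the part of the graph inside the box. It contains the base point, which lies below
   [x], and the covers of that point. *)
pose code f : {set B * B} := finset (fun p : B * B => f (T p.1) == Some (T p.2)).
pose A := [set f : ipf P | f x = Some y].
have xN i : (coord x i < N.-1)%N.
  by rewrite ltnS (leq_trans (leq_maxl _ (coord y i))) // leq_bigmax.
have yN i : (coord y i < N.-1)%N.
  by rewrite ltnS (leq_trans (leq_maxr (coord x i) _)) // leq_bigmax.
have codeP f g z w : code f = code g -> z <= x -> w <= y ->
    (f z = Some w -> g z = Some w) /\
    (forall i j, f (incr i z) = Some (incr j w) ->
       g (incr i z) = Some (incr j w)).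
  move=> /setP fg /le_coordP zx /le_coordP wy; split.
    have [i|b <-] := TP z; first by have := zx i; have := xN i; lia.
    have [i|c <-] := TP w; first by have := wy i; have := yN i; lia.
    by move=> /eqP fz; have := fg (b, c); rewrite !inE /= fz => /esym/eqP.
  move=> i j.
  have [k|b <-] := TP (incr i z).
    by rewrite coord_incr; have := zx k; have := xN k; case: eqP => _; lia.
  have [k|c <-] := TP (incr j w).
    by rewrite coord_incr; have := wy k; have := yN k; case: eqP => _; lia.
  by move=> /eqP fz; have := fg (b, c); rewrite !inE /= fz => /esym/eqP.
have code_inj : {in A &, injective code}.
  move=> f g; rewrite !inE /A /= => fx gx fg.
  have [u [v [fu umin vmin]]] := ipf_base f.
  have [u' [v' [gu' umin' vmin']]] := ipf_base g.
  have [gu fgb] := codeP _ _ _ _ fg (umin _ _ fx) (vmin _ _ fx).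
  have [fu' _] := codeP _ _ _ _ (esym fg) (umin' _ _ gx) (vmin' _ _ gx).
  have {}gu := gu fu; have {}fu' := fu' gu'.
  have uu' : u = u' by apply/le_anti; rewrite (umin _ _ fu') (umin' _ _ gu).
  have fgu : forall z, u <= z -> f z = g z.
    apply: (ipf_eq_up fu gu) => i; have [j fj] := ipf_incr i fu.
    by rewrite fj (fgb _ _ fj).
  apply/val_inj/funext => z /=.
  have [/fgu//|uz] := boolP (u <= z).
  case fz: (f z) => [a|]; first by rewrite (umin _ _ fz) in uz.
  case gz: (g z) => [a|//]; have := umin' _ _ gz.
  by rewrite -uu' (negPf uz).
have := @finite_finset _ (code @` A).
by have /inj_card_eq/eq_finite_set <- := code_inj.
Qed.

End PosTuple.

(** * Idempotents, translations, one-sided inverses and units *)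

Section Shifts.
Local Open Scope order_scope.
Context {n : nat}.
Notation P := (n.-tupleprod posnat).
Implicit Types (x y z w : P) (u v a b : IPF_N n).

Lemma id_up_subproof x :
  `[< principal_filter_iso (fun z => if x <= z then Some z else None) >].
Proof.
apply/asboolP; exists x, x; split.
- apply/seteqP; split=> z; rewrite /pmap_dom /principal_filter /=.
    by case=> w; case: ifP.
  by move=> xz; exists z; rewrite xz.
- apply/seteqP; split=> w; rewrite /pmap_codom /principal_filter /=.
    by case=> z; case: ifP => // xz [<-].
  by move=> xw; exists w; rewrite xw.
- by move=> z1 z2 w1 w2; case: ifP => // _ [<-]; case: ifP => // _ [<-].
Qed.

(** The idempotent e_k is [id_up (incr k pbot)]. *)
Definition id_up x : IPF_N n := Ipf (id_up_subproof x).

Definition ipf_id : IPF_N n := id_up pbot.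

Lemma ipf_idE z : ipf_id z = Some z.
Proof. by rewrite /= le_pbot. Qed.

(** In shifted coordinates this is addition, so [pbot] is sent to [x]. *)
Definition translate x z : P := of_coord (fun i => coord z i + coord x i)%N.

Definition untranslate x z : P := of_coord (fun i => coord z i - coord x i)%N.

Lemma coord_translate x z i : coord (translate x z) i = (coord z i + coord x i)%N.
Proof. exact: of_coordK. Qed.

Lemma coord_untranslate x z i :
  coord (untranslate x z) i = (coord z i - coord x i)%N.
Proof. exact: of_coordK. Qed.

Lemma translateK x : cancel (translate x) (untranslate x).
Proof.
by move=> z; apply: coord_inj => i; rewrite coord_untranslate coord_translate addnK.
Qed.

Lemma untranslateK x z : x <= z -> translate x (untranslate x z) = z.
Proof.
move=> /le_coordP xz; apply: coord_inj => i.
by rewrite coord_translate coord_untranslate subnK.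
Qed.

Lemma le_translate x z : x <= translate x z.
Proof. by apply/le_coordP => i; rewrite coord_translate leq_addl. Qed.

Lemma le_translate2 x z w : (translate x z <= translate x w) = (z <= w).
Proof.
by apply/le_coordP/le_coordP => zw i; have := zw i;
  rewrite !coord_translate leq_add2r.
Qed.

Lemma shift_up_subproof x :
  `[< principal_filter_iso (fun z => Some (translate x z)) >].
Proof.
apply/asboolP; exists pbot, x; split.
- apply/seteqP; split=> z _; first exact: le_pbot.
  by exists (translate x z).
- apply/seteqP; split=> w; rewrite /pmap_codom /principal_filter /=.
    by case=> z [<-]; exact: le_translate.
  by move=> xw; exists (untranslate x w); rewrite untranslateK.
- by move=> z1 z2 w1 w2 [<-] [<-]; exact: le_translate2.
Qed.

Definition shift_up x : IPF_N n := Ipf (shift_up_subproof x).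

Lemma shift_down_subproof x :
  `[< principal_filter_iso
        (fun z => if x <= z then Some (untranslate x z) else None) >].
Proof.
apply/asboolP; exists x, pbot; split.
- apply/seteqP; split=> z; rewrite /pmap_dom /principal_filter /=.
    by case=> w; case: ifP.
  by move=> xz; exists (untranslate x z); rewrite xz.
- apply/seteqP; split=> w; rewrite /pmap_codom /principal_filter /=.
    by move=> _; exact: le_pbot.
  by move=> _; exists (translate x w); rewrite le_translate translateK.
- move=> z1 z2 w1 w2; case: ifP => // xz1 [<-]; case: ifP => // xz2 [<-].
  by rewrite -(le_translate2 x) !untranslateK.
Qed.

Definition shift_down x : IPF_N n := Ipf (shift_down_subproof x).

Lemma ipf_mulE u v z : (u * v)%g z = pcomp v u z.
Proof. by []. Qed.

Lemma shift_up_down x : (shift_up x * shift_down x)%g = ipf_id.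
Proof.
apply/val_inj/funext => z /=.
by rewrite /pcomp /= le_translate translateK le_pbot.
Qed.

Lemma shift_up_inj : injective shift_up.
Proof.
move=> x y xy; apply: coord_inj => i.
have /Some_inj/(congr1 (coord ^~ i)) : Some (translate x pbot) = Some (translate y pbot).
  exact: (congr1 (fun u : IPF_N n => u pbot) xy).
by rewrite !coord_translate !of_coordK.
Qed.

(** Evaluation at [pbot] reduces the equation to maps through a given pair of points. *)
Lemma ipf_mul_eq1 a b : (a * b)%g = ipf_id ->
  exists y, a pbot = Some y /\ b y = Some pbot.
Proof.
move=> /(congr1 (fun u : IPF_N n => u pbot)); rewrite ipf_idE ipf_mulE /pcomp.
by case: (a pbot) => // y /= by1; exists y.
Qed.

Lemma finite_right_inverses a : finite_set [set b | (a * b)%g = ipf_id].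
Proof.
case a1 : (a pbot) => [y|]; last first.
  suff -> : [set b | (a * b)%g = ipf_id] = set0 by [].
  by apply/seteqP; split=> // b /= /ipf_mul_eq1[y []]; rewrite a1.
apply: sub_finite_set (finite_ipf_through y pbot) => b /= /ipf_mul_eq1[y' []].
by rewrite a1 => -[->].
Qed.

(** Since [b] is injective, at most one [y] is sent to [pbot], and every solution [a] maps [pbot] to
    that [y]. *)
Lemma finite_left_inverses b : finite_set [set a | (a * b)%g = ipf_id].
Proof.
have [[y by1]|by1] := pselect (exists y, b y = Some pbot).
  apply: sub_finite_set (finite_ipf_through pbot y) => a /= /ipf_mul_eq1[y' []].
  by move=> -> by'; rewrite (ipf_inj by1 by').
suff -> : [set a | (a * b)%g = ipf_id] = set0 by [].
by apply/seteqP; split=> // a /= /ipf_mul_eq1[y [_ ?]]; apply: by1; exists y.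
Qed.

Lemma id_up_mul x u :
  (forall z w, u z = Some w -> x <= z) -> (id_up x * u)%g = u.
Proof.
move=> xu; apply/val_inj/funext => z /=; rewrite /pcomp /=; case: ifP => //= xz.
by case uz: (u z) => [w|//]; rewrite (xu _ _ uz) in xz.
Qed.

Lemma mul_id_up x u :
  (forall z w, u z = Some w -> x <= w) -> (u * id_up x)%g = u.
Proof.
move=> xu; apply/val_inj/funext => z /=; rewrite /pcomp /=.
by case uz: (u z) => [w|//] /=; rewrite (xu _ _ uz).
Qed.

(** If the least point of the domain or of the range were not [pbot], it would lie above some
    [incr i pbot], and multiplying by that idempotent on the corresponding side would not change
    [u]. *)
Lemma ipf_unitP u :
  (forall i, (id_up (incr i pbot) * u)%g <> u) ->
  (forall i, (u * id_up (incr i pbot))%g <> u) ->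
  u pbot = Some pbot.
Proof.
move=> nl nr; have [x [y [ux xmin ymin]]] := ipf_base u.
have bot z : (forall i, ~ (incr i pbot <= z)) -> z = pbot.
  move=> zP; apply/esym/eqP/negPn/negP => nz.
  have /lt_incr_le[i] : pbot < z by rewrite lt_neqAle nz le_pbot.
  exact: zP.
rewrite -{1}(bot x) => [|i ix]; first rewrite ux (bot y) // => i iy.
  apply: (nr i); apply: mul_id_up => z w /ymin; exact: le_trans.
by apply: (nl i); apply: id_up_mul => z w /xmin; exact: le_trans.
Qed.

Lemma id_up_incr_neq1 i : id_up (incr i pbot) <> ipf_id.
Proof.
move=> /(congr1 (fun u : IPF_N n => u pbot)); rewrite ipf_idE /=.
by have := lt_incr i (@pbot n); rewrite lt_leAnge => /andP[_ /negPf ->].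
Qed.

Lemma ipf_mul1 u : (u * ipf_id)%g = u.
Proof. by apply: mul_id_up => z w _; exact: le_pbot. Qed.

Lemma ipf_1mul u : (ipf_id * u)%g = u.
Proof. by apply: id_up_mul => z w _; exact: le_pbot. Qed.

End Shifts.

(** * Equalizers, finite open sets and feeble compactness in general spaces *)

Lemma closed_eq_fun (T U : topologicalType) (f g : T -> U) :
  hausdorff_space U -> continuous f -> continuous g -> closed [set x | f x = g x].
Proof.
rewrite open_hausdorff => hU cf cg; rewrite -openC openE => x /= /eqP fgx.
have [[A B] /= [/set_mem Af /set_mem Bg] [oA oB AB]] := hU _ _ fgx.
have nA : nbhs x (f @^-1` A) by apply: cf; exact: open_nbhs_nbhs.
have nB : nbhs x (g @^-1` B) by apply: cg; exact: open_nbhs_nbhs.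
rewrite /interior; apply: filterS (filterI nA nB) => z [/= Afz Bgz] fgz.
by move/eqP: AB => /seteqP[/(_ (f z))] + _; apply; split; rewrite // fgz.
Qed.

Section FiniteTrace.
Context {T : topologicalType} (T1 : accessible_space T).
Implicit Types (R U : set T).

Let finite_closed := (accessible_finite_set_closed.1 T1).

(** Removing the finite, hence closed, trace from [U] leaves an open set that misses [R], so nothing
    is left. *)
Lemma dense_finite_open R U :
  dense R -> open U -> finite_set (U `&` R) -> finite_set U.
Proof.
move=> dR oU fUR; apply: sub_finite_set (fUR) => x Ux.
apply: contrapT => nx.
have [] := dR (U `&` ~` (U `&` R)); first by exists x.
  by apply: openI => //; rewrite openC; exact: finite_closed.
by move=> y [[Uy nUR] Ry]; apply: nUR.
Qed.

Lemma finite_open_isolated U x : open U -> finite_set U -> U x -> open [set x].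
Proof.
move=> oU fU Ux; have -> : [set x] = U `&` ~` (U `\ x).
  apply/seteqP; split=> [y ->|y [Uy /= nUy]]; first by split=> // -[_]; apply.
  by apply: contrapT => yx; apply: nUy.
by apply: openI => //; rewrite openC; apply: finite_closed; exact: finite_setD.
Qed.

End FiniteTrace.

(** The complement of [D] and the singletons of points of [D] form an open partition, so each point
    has a neighbourhood meeting just one member. *)
Lemma clopen_isolated_finite (X : topologicalType) (D : set X) :
  feebly_compact X -> closed D -> (forall p, D p -> open [set p]) ->
  finite_set D.
Proof.
move=> fcX cD iD; pose F := [set A | A = ~` D \/ exists2 p, D p & A = [set p]].
have : finite_set F.
  apply: fcX => [A [->|[p Dp ->]]||p].
  - by rewrite openC.
  - exact: iD.
  - apply/seteqP; split=> // p _; have [Dp|nDp] := pselect (D p).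
      by exists [set p] => //; right; exists p.
    by exists (~` D) => //; left.
  have [Dp|nDp] := pselect (D p).
    exists [set p]; first by apply: open_nbhs_nbhs; split=> //; exact: iD.
    apply: sub_finite_set (finite_set1 [set p]).
    by move=> A [[->|[q Dq ->]] [r [+ rp]]]; rewrite rp //= => ->.
  exists (~` D); first by apply: open_nbhs_nbhs; split=> //; rewrite openC.
  apply: sub_finite_set (finite_set1 (~` D)).
  by move=> A [[->//|[q Dq ->]] [r [/= -> /(_ Dq)]]].
move=> fF; have inj1 : {in D &, injective (@set1 X)}.
  by move=> p q _ _ /seteqP[/(_ p erefl)].
rewrite -(eq_finite_set (inj_card_eq inj1)).
by apply: sub_finite_set fF => A [p Dp <-]; right; exists p.
Qed.

(** * Isolated points of [S] and of its square *)

Section DenseIPF.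
Context {n : nat} {S : topologicalSemigroupType}.
Context (S_hausdorff : hausdorff_space S) (i : {multiplicative IPF_N n -> S}).
Context (i_inj : injective i) (i_dense : dense (range i)).

Let S_T1 : accessible_space S := hausdorff_accessible S_hausdorff.

Let mulL_continuous (a : S) : continuous (fun s : S => (a * s)%g).
Proof.
move=> s; apply: (@continuous_comp _ _ _ (fun s => (a, s)) (fun p => (p.1 * p.2)%g)).
  by apply: cvg_pair; [exact: cvg_cst|exact: cvg_id].
exact: mulg_continuous.
Qed.

Let mulR_continuous (a : S) : continuous (fun s : S => (s * a)%g).
Proof.
move=> s; apply: (@continuous_comp _ _ _ (fun s => (s, a)) (fun p => (p.1 * p.2)%g)).
  by apply: cvg_pair; [exact: cvg_id|exact: cvg_cst].
exact: mulg_continuous.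
Qed.

Lemma finite_open_trace (U : set S) :
  open U -> finite_set (i @^-1` U) -> finite_set U.
Proof.
move=> oU fU; apply: (dense_finite_open S_T1 i_dense oU).
apply: sub_finite_set (finite_image i fU).
by move=> s [Us [u _ us]]; exists u; rewrite //= us.
Qed.

Lemma isolated_id : open [set i ipf_id].
Proof.
pose e k : S := i (id_up (incr k pbot)).
(* The inequations that characterize units; [W] is open because its complement is a finite union of
   equalizers. *)
pose W := \bigcap_(k in [set: 'I_n])
  (~` [set s | (e k * s)%g = s] `&` ~` [set s | (s * e k)%g = s]).
have oW : open W.
  rewrite -closedC setC_bigcap; apply: closed_bigcup => [|k _]; first exact: finite_finset.
  rewrite setCI !setCK; by apply: closedU; apply: closed_eq_fun => // s; exact: cvg_id.
apply: (finite_open_isolated S_T1 oW).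
  apply: finite_open_trace => //.
  apply: sub_finite_set (finite_ipf_through (@pbot n) pbot) => u Wu /=.
  by apply: ipf_unitP => k eu; have [] := Wu k Logic.I; rewrite /= /e -!gmulfM eu.
(* The identity satisfies the inequations because no e_k equals it. *)
move=> k _; split; rewrite /= /e -gmulfM => /i_inj; rewrite ?ipf_mul1 ?ipf_1mul;
  exact: id_up_incr_neq1.
Qed.

Let D := [set p : S * S | (p.1 * p.2)%g = i ipf_id].

Lemma isolated_inverse_pair p : D p -> open [set p].
Proof.
case: p => x y /= xy.
have : nbhs (x, y) (fun p => (p.1 * p.2)%g = i ipf_id).
  apply: (@mulg_continuous S (x, y) [set i ipf_id]); rewrite /= xy.
  by apply: open_nbhs_nbhs; split=> //; exact: isolated_id.
case=> [[U V] /= [nU nV] UV].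
have Uo := open_interior U; have Vo := open_interior V.
have {}UV a b : U° a -> V° b -> (a * b)%g = i ipf_id.
  by move=> /interior_subset Ua /interior_subset Vb; exact: (UV (a, b)).
(* The points [x] and [y] may lie outside the range of [i]; density replaces them by images of some
   [a] and [b]. The trace of each neighbourhood then consists of one-sided inverses of [b] or of
   [a]. *)
have [s [Us [a _ sa]]] : U° `&` range i !=set0 by apply: i_dense => //; exists x.
have [t [Vt [b _ tb]]] : V° `&` range i !=set0 by apply: i_dense => //; exists y.
rewrite -{}sa in Us; rewrite -{}tb in Vt.
have ab1 u v : (i u * i v)%g = i ipf_id -> (u * v)%g = ipf_id.
  by rewrite -gmulfM => /i_inj.
have fU : finite_set U°.
  apply: finite_open_trace => //; apply: sub_finite_set (finite_left_inverses b).
  by move=> u /= Uu; apply: ab1; exact: UV.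
have fV : finite_set V°.
  apply: finite_open_trace => //; apply: sub_finite_set (finite_right_inverses a).
  by move=> v /= Vv; apply: ab1; exact: UV.
have ox := finite_open_isolated S_T1 Uo fU nU.
have oy := finite_open_isolated S_T1 Vo fV nV.
rewrite openE => _ ->; exists ([set x], [set y]) => /=.
  by split; apply: open_nbhs_nbhs; split.
by case=> a' b' [/= -> ->].
Qed.

Lemma closed_inverse_pairs : closed D.
Proof.
apply: closed_eq_fun => //; first exact: mulg_continuous.
exact: cst_continuous.
Qed.

Lemma infinite_inverse_pairs : (0 < n)%N -> infinite_set D.
Proof.
(* Translations along the diagonal; since [n] is positive, there is a coordinate from which [k] can
   be read off. *)
move=> n_gt0 fD; pose c k : IPF_N n * IPF_N n :=
  (shift_up (of_coord (fun=> k)), shift_down (of_coord (fun=> k))).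
pose h k := (i (c k).1, i (c k).2).
have hinj : injective h.
  move=> k l [/i_inj/shift_up_inj + _] => /(congr1 (coord ^~ (Ordinal n_gt0))).
  by rewrite !of_coordK.
apply: infinite_nat.
apply: sub_finite_set (finite_preimage (B := D) (f := h) _ fD); last by move=> k l _ _ /hinj.
by move=> k _; rewrite /D /= -gmulfM shift_up_down.
Qed.

End DenseIPF.

Theorem theorem3p5 (n : nat) (n_gt0 : (0 < n)%N)
    (S : topologicalSemigroupType) (S_hausdorff : hausdorff_space S)
    (i : {multiplicative IPF_N n -> S}) (i_inj : injective i)
    (i_dense : dense (range i)) :
  ~ feebly_compact (S * S)%type.
Proof.
move=> fc; apply: (@infinite_inverse_pairs _ _ i i_inj n_gt0).
apply: clopen_isolated_finite fc _ _; first exact: closed_inverse_pairs.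
exact: isolated_inverse_pair.
Qed.
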